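(* Let $V_1,V_2,V_3$ be complex vector spaces of dimension $3$ and let $T\in V_1\otimes V_2\otimes V_3$ be a tensor such that the plane cubic $E^1_T$ is a smooth elliptic curve. Then, for each $i\in\{1,2,3\}$, the collineation variety $\mathscr{C}^i_2(T)$ is (up to linear isomorphism) the Veronese surface $\nu_2(\mathbb{P}^2)\subset\mathbb{P}^5$.
   Context: For $i\in\{1,2,3\}$ and $\{i,j,l\}=\{1,2,3\}$, the contraction (flattening) map $V_i^*\to V_j\otimes V_l$ has image $T(V_i^* )$, regarded as a $3\times3$ matrix of linear forms on $V_i^*$. The scheme $E^i_T\subseteq\mathbb{P}V_i^*$ is the plane curve defined by the cubic form $\det(T(V_i^* ))$. The collineation variety $\mathscr{C}^i_2(T)\subseteq\mathbb{P}(\Lambda^2V_j\otimes\Lambda^2V_l)$ is the Zariski closure of the image of the rational map $\mathbb{P}(V_i^* )\dashrightarrow\mathbb{P}(\Lambda^2V_j\otimes\Lambda^2V_l)$ whose coordinates are the $2\times2$ minors of this matrix. Up to linear isomorphism means: up to projective equivalence within its linear span. *)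

(* Defs.v *)
From HB Require Import structures.
From mathcomp Require Import all_boot all_order all_algebra.
From mathcomp Require Import boolp classical_sets reals.
From mathcomp Require Import complex mpoly.

Set Implicit Arguments.
Unset Strict Implicit.
Unset Printing Implicit Defensive.

Import GRing.Theory.

Local Open Scope ring_scope.
Local Open Scope classical_set_scope.

Section Projective.
Variable K : fieldType.

(* A point of P^(n-1) is given by its homogeneous coordinates, a nonzero row
   vector; a subset of P^(n-1) is given by the set of all nonzero vectors
   representing its points (its affine cone without the origin). *)

(* The image of the rational map P^(m-1) --> P^(n-1), [x] |-> [f x], on the
   locus where f does not vanish; f is meant to be homogeneous. *)
Definition proj_image m n (f : 'rV[K]_m -> 'rV[K]_n) : set 'rV[K]_n :=
  [set y | exists x c, [/\ x != 0, f x != 0, c != 0 & y = c *: f x]].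

Definition zariski_closure n (X : set 'rV[K]_n) : set 'rV[K]_n :=
  [set y : 'rV[K]_n | y != 0 /\
    forall d (p : {mpoly K[n]}), p \is d.-homog ->
      (forall x, X x -> p.@[x 0] = 0) -> p.@[y 0] = 0].

Definition is_linear_span n (X : set 'rV[K]_n) (U : {vspace 'rV[K]_n}) : Prop :=
  (forall x, X x -> x \in U) /\
  forall W : {vspace 'rV[K]_n}, (forall x, X x -> x \in W) -> (U <= W)%VS.

(* Only the restriction of f to the span U of X matters: it is an isomorphism
   from U onto the span W of Y, and it carries X onto Y. *)
Definition linearly_isomorphic n m (X : set 'rV[K]_n) (Y : set 'rV[K]_m)
    : Prop :=
  exists (U : {vspace 'rV[K]_n}) (W : {vspace 'rV[K]_m})
         (f : 'Hom('rV[K]_n, 'rV[K]_m)),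
    [/\ is_linear_span X U, is_linear_span Y W,
        (U :&: lker f = 0)%VS, (f @: U = W)%VS & f @` X = Y].

Definition veronese_map (x : 'rV[K]_3) : 'rV[K]_6 :=
  let x0 := x 0 (inord 0) in let x1 := x 0 (inord 1) in
  let x2 := x 0 (inord 2) in
  \row_(k < 6) nth 0 [:: x0 ^+ 2; x0 * x1; x0 * x2; x1 ^+ 2; x1 * x2; x2 ^+ 2] k.

Definition veronese_surface : set 'rV[K]_6 := proj_image veronese_map.

(* The curve F = 0 in P^2 is a smooth cubic: Jacobian criterion. *)
Definition smooth_plane_cubic (F : {mpoly K[3]}) : Prop :=
  [/\ F \is 3.-homog, F != 0 &
    forall x : 'rV[K]_3, x != 0 -> F.@[x 0] = 0 ->
      exists k : 'I_3, (F^`M(k)).@[x 0] != 0].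

End Projective.

Arguments veronese_surface K : clear implicits.

Section Tensors.
Variable K : fieldType.

Definition dual (V : vectType K) : vectType K := 'Hom(V, K^o).

(* V_0 (x) V_1 (x) V_2 is the space of trilinear forms on the duals. *)
Record tensor (V : 'I_3 -> vectType K) := Tensor {
  tensor_form :> (forall k, dual (V k)) -> K;
  tensor_multilinear : forall (x : forall k, dual (V k)) (k : 'I_3)
      (a : K) (u v : dual (V k)),
    tensor_form (dfwith x (a *: u + v)) =
    a * tensor_form (dfwith x u) + tensor_form (dfwith x v) }.

Variables (V : 'I_3 -> vectType K) (e : forall k, 3.-tuple (dual (V k))).
Variable T : tensor V.

(* For {i, j, l} = {0, 1, 2}, the bilinear form on V_j^* x V_l^*, i.e. the
   element of V_j (x) V_l, to which the contraction V_i^* -> V_j (x) V_l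
   sends alpha. *)
Definition contraction (i j l : 'I_3) (alpha : dual (V i))
    (beta : dual (V j)) (gamma : dual (V l)) : K :=
  T (dfwith (dfwith (dfwith (fun k => 0 : dual (V k)) alpha) beta) gamma).

(* The image of the contraction as a matrix of linear forms on V_i^*, in bases
   e k of the V_k^*; the variable X_c is the c-th coordinate on V_i^*. *)
Definition flattening (i j l : 'I_3) : 'M[{mpoly K[3]}]_3 :=
  \matrix_(a, b) \sum_(c < 3)
    contraction (tnth (e i) c) (tnth (e j) a) (tnth (e l) b) *: 'X_c.

Definition flattening_det (i j l : 'I_3) : {mpoly K[3]} :=
  \det (flattening i j l).

(* The 2 x 2 minors, indexed by the omitted row and column, are the
   coordinates on Lambda^2 V_j (x) Lambda^2 V_l, which has dimension 9. *)
Definition collineation_map (i j l : 'I_3) (x : 'rV[K]_3) : 'rV[K]_(3 * 3) :=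
  mxvec (\matrix_(a, b) (\det (row' a (col' b (flattening i j l)))).@[x 0]).

Definition collineation_variety (i j l : 'I_3) : set 'rV[K]_(3 * 3) :=
  zariski_closure (proj_image (collineation_map i j l)).

End Tensors.

(* Main.v *)
Require Import Defs.
From HB Require Import structures.
From mathcomp Require Import all_boot all_order all_algebra.
From mathcomp Require Import boolp classical_sets reals.
From mathcomp Require Import complex mpoly.
From mathcomp Require Import ring.

(* For each i, write M(x) for the i-th flattening, a 3 x 3 matrix of linear forms.
   Its nine 2 x 2 minors are quadrics in x, so they factor through the Veronese
   map; the collineation variety is a linear copy of the Veronese surface as
   soon as the minors span the 6-dimensional space of quadrics.

   Call the tensor degenerate if there are nonzero x, y, z such that
   T(x, y, -), T(x, -, z) and T(-, y, z) all vanish.  This is symmetric in the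
   three factors, and it makes the cubic det M singular at x, so a smooth E^1_T
   makes T nondegenerate for every i at once.

   If the minors do not span, some nonzero quadratic form q in the partial
   derivatives annihilates them.  Diagonalizing q reduces to three cases, where
   minorsD is the polarization of minors and A, B, C are the slices of the
   tensor in a basis adapted to q:
     minors A = 0,   minorsD A B = 0,   minorsD A B + minors C = 0.
   In the last one the isometries of the conic q allow one to assume det A = 0,
   because a sextic polynomial has a root.  Then A can be taken to be
   diag(1, 1, 0), and in each case the equations exhibit a degenerate triple. *)

Set Implicit Arguments.
Unset Strict Implicit.
Unset Printing Implicit Defensive.

Import GRing.Theory Num.Theory.
Local Open Scope ring_scope.
Local Open Scope complex_scope.

(** * Explicit coordinates in dimension 3 *)

Local Notation o0 := (@Ordinal 3 0 isT).
Local Notation o1 := (@Ordinal 3 1 isT).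
Local Notation o2 := (@Ordinal 3 2 isT).

Lemma ord3_ind (P : 'I_3 -> Prop) : P o0 -> P o1 -> P o2 -> forall i, P i.
Proof.
move=> P0 P1 P2 [[|[|[|//]]] lti].
- by rewrite (_ : Ordinal _ = o0) //; apply: val_inj.
- by rewrite (_ : Ordinal _ = o1) //; apply: val_inj.
- by rewrite (_ : Ordinal _ = o2) //; apply: val_inj.
Qed.

Lemma big_ord3 (V : nmodType) (F : 'I_3 -> V) :
  \sum_(i < 3) F i = F o0 + F o1 + F o2.
Proof.
rewrite 3!big_ord_recl big_ord0 addr0 addrA.
by congr (F _ + F _ + F _); apply: val_inj.
Qed.

Definition rv3 (K : Type) (a b c : K) : 'rV[K]_3 :=
  \row_i nth a [:: a; b; c] i.

Definition mx3 (K : Type) (u v w : 'rV[K]_3) : 'M[K]_3 :=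
  \matrix_(i, j) nth u [:: u; v; w] i 0 j.

Lemma rv3E (K : Type) (a b c : K) :
  (rv3 a b c 0 o0 = a) * (rv3 a b c 0 o1 = b) * (rv3 a b c 0 o2 = c).
Proof. by rewrite !mxE. Qed.

Lemma mx3E (K : Type) (u v w : 'rV[K]_3) j :
  (mx3 u v w o0 j = u 0 j) * (mx3 u v w o1 j = v 0 j) *
  (mx3 u v w o2 j = w 0 j).
Proof. by rewrite !mxE. Qed.

Lemma rv3_neq0 (K : nmodType) (a b c : K) :
  [|| a != 0, b != 0 | c != 0] -> rv3 a b c != 0.
Proof.
apply: contraL => /eqP /rowP r0; rewrite !negb_or !negbK.
by have := (r0 o0, r0 o1, r0 o2); rewrite !mxE /= => -[[-> ->] ->]; rewrite eqxx.
Qed.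

Lemma mxDE (V : nmodType) m n (A B : 'M[V]_(m, n)) i j :
  (A + B) i j = A i j + B i j.
Proof. by rewrite mxE. Qed.

Lemma mxZE (R : pzSemiRingType) m n k (A : 'M[R]_(m, n)) i j :
  (k *: A) i j = k * A i j.
Proof. by rewrite mxE. Qed.

(** * The matrix of 2 x 2 minors and its polarization *)

Section Minors.
Variable R : comNzRingType.
Implicit Types A B C : 'M[R]_3.

Lemma lift_ord3 :
  [/\ lift o0 0 = o1, lift o0 1 = o2 & lift o1 0 = o0] /\
  [/\ lift o1 1 = o2, lift o2 0 = o0 & lift o2 1 = o1].
Proof. by do !split; apply: val_inj. Qed.

Lemma det_mx2 (M : 'M[R]_2) : \det M = M 0 0 * M 1 1 - M 0 1 * M 1 0.
Proof.
have l0 : lift 0 0 = 1 :> 'I_2 by apply: val_inj.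
have l1 : lift 1 0 = 0 :> 'I_2 by apply: val_inj.
rewrite (expand_det_row _ 0) /cofactor 2!big_ord_recl big_ord0 !det_mx11 !mxE.
by rewrite !l0 l1 /= /bump /= expr0 expr1; ring.
Qed.

(** No cofactor signs: this is $\Lambda^2 A$ in bases indexed by the omitted row and column, which
    makes it multiplicative (Cauchy-Binet) without any twist. *)
Definition minors A : 'M[R]_3 := \matrix_(a, b) \det (row' a (col' b A)).

Lemma minorsE A a b : minors A a b =
  A (lift a 0) (lift b 0) * A (lift a 1) (lift b 1)
  - A (lift a 0) (lift b 1) * A (lift a 1) (lift b 0).
Proof. by rewrite mxE det_mx2 !mxE. Qed.

Lemma det_mx3 A : \det A =
  A o0 o0 * minors A o0 o0 - A o0 o1 * minors A o0 o1 + A o0 o2 * minors A o0 o2.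
Proof.
by rewrite (expand_det_row _ o0) big_ord3 /cofactor !mxE /= expr0 expr1 -signr_odd expr0; ring.
Qed.

Definition minorsD A B : 'M[R]_3 := minors (A + B) - minors A - minors B.

Lemma minorsDE A B a b : minorsD A B a b =
  A (lift a 0) (lift b 0) * B (lift a 1) (lift b 1)
  + B (lift a 0) (lift b 0) * A (lift a 1) (lift b 1)
  - A (lift a 0) (lift b 1) * B (lift a 1) (lift b 0)
  - B (lift a 0) (lift b 1) * A (lift a 1) (lift b 0).
Proof.
have subE (X Y : 'M[R]_3) : (X - Y) a b = X a b - Y a b by rewrite !mxE.
by rewrite /minorsD !subE !minorsE ![(A + B) _ _]mxE; ring.
Qed.

Lemma minorsM A B : minors (A *m B) = minors A *m minors B.
Proof.
have [[l1 l2 l3] [l4 l5 l6]] := lift_ord3.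
apply/matrixP; elim/ord3_ind; elim/ord3_ind;
 by rewrite [RHS]mxE big_ord3 !minorsE ?(l1, l2, l3, l4, l5, l6) !mxE !big_ord3; ring.
Qed.

End Minors.

(** * Degenerate tensors and changes of bases *)

Section Degenerate.
Variable K : fieldType.
Implicit Types (S : 'I_3 -> 'M[K]_3) (A B C P G H : 'M[K]_3).

Definition degenerate S : Prop :=
  exists x y z : 'rV[K]_3, [/\ x != 0, y != 0 & z != 0] /\
    [/\ y *m (\sum_c x 0 c *: S c) = 0, (\sum_c x 0 c *: S c) *m z^T = 0
      & forall c, y *m S c *m z^T = 0].

Definition slices3 A B C : 'I_3 -> 'M[K]_3 := fun c => nth A [:: A; B; C] c.

Lemma mulmx_unit_neq0 m (x : 'rV[K]_m) (U : 'M_m) :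
  U \in unitmx -> x != 0 -> x *m U != 0.
Proof.
move=> uU; apply: contraNneq => /(congr1 (mulmx^~ (invmx U))).
by rewrite mulmxK // mul0mx => ->.
Qed.

Lemma degenerate_recombine P S : P \in unitmx ->
  degenerate (fun k => \sum_c P k c *: S c) -> degenerate S.
Proof.
move=> uP [x [y [z [[x0 y0 z0] [e1 e2 e3]]]]].
have E : \sum_c (x *m P) 0 c *: S c = \sum_k x 0 k *: (\sum_c P k c *: S c).
  under [RHS]eq_bigr => k _ do rewrite scaler_sumr.
  rewrite exchange_big; apply: eq_bigr => c _; rewrite mxE scaler_suml.
  by apply: eq_bigr => k _; rewrite scalerA.
exists (x *m P), y, z; split; first by split=> //; exact: mulmx_unit_neq0.
split; rewrite ?E // => c.
(* The third condition concerns every single slice, so each [S c] is recovered from the recombined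
   slices through the inverse of P. *)
have -> : S c = \sum_k invmx P c k *: \sum_d P k d *: S d.
  under eq_bigr => k _ do rewrite scaler_sumr.
  rewrite exchange_big /=; under eq_bigr => d _.
    under eq_bigr => k _ do rewrite scalerA.
    rewrite -scaler_suml; have -> : \sum_k invmx P c k * P k d = (c == d)%:R.
      by have := mulVmx uP => /matrixP /(_ c d); rewrite !mxE.
    over.
  rewrite (bigD1 c) //= eqxx scale1r big1 ?addr0 // => d; rewrite eq_sym => /negPf ->.
  by rewrite scale0r.
rewrite mulmx_sumr mulmx_suml big1 // => k _.
by rewrite -scalemxAr -scalemxAl e3 scaler0.
Qed.

Lemma degenerate_equivalent G H S : G \in unitmx -> H \in unitmx ->
  degenerate (fun c => G *m S c *m H) -> degenerate S.
Proof.
move=> uG uH [x [y [z [[x0 y0 z0] [e1 e2 e3]]]]].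
have E : \sum_c x 0 c *: (G *m S c *m H) = G *m (\sum_c x 0 c *: S c) *m H.
  rewrite mulmx_sumr mulmx_suml; apply: eq_bigr => c _.
  by rewrite -scalemxAr -scalemxAl.
exists x, (y *m G), (z *m H^T); split.
  by split; rewrite // mulmx_unit_neq0 // unitmx_tr.
rewrite E in e1 e2; split=> [||c].
- by apply: (can_inj (mulmxK uH)); rewrite mul0mx -e1 !mulmxA.
- apply: (can_inj (mulKmx uG)); rewrite mulmx0 -e2 trmx_mul trmxK.
  by rewrite !mulmxA.
- by rewrite trmx_mul trmxK -(e3 c) !mulmxA.
Qed.

Lemma eq_degenerate S S' : S =1 S' -> degenerate S -> degenerate S'.
Proof.
move=> eS [x [y [z [nz [e1 e2 e3]]]]]; exists x, y, z; split=> //.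
have E : \sum_c x 0 c *: S' c = \sum_c x 0 c *: S c by apply: eq_bigr => c; rewrite eS.
by split=> [||c]; rewrite ?E -?eS.
Qed.

Lemma degenerate_mx3 P A B C : \det P != 0 ->
  degenerate (slices3 (P o0 o0 *: A + P o0 o1 *: B + P o0 o2 *: C)
                      (P o1 o0 *: A + P o1 o1 *: B + P o1 o2 *: C)
                      (P o2 o0 *: A + P o2 o1 *: B + P o2 o2 *: C)) ->
  degenerate (slices3 A B C).
Proof.
move=> dP D; apply: (@degenerate_recombine P); first by rewrite unitmxE unitfE.
by apply: eq_degenerate D; elim/ord3_ind; rewrite big_ord3.
Qed.

Lemma degenerate_equivalent3 G H A B C : G \in unitmx -> H \in unitmx ->
  degenerate (slices3 (G *m A *m H) (G *m B *m H) (G *m C *m H)) ->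
  degenerate (slices3 A B C).
Proof.
move=> uG uH D; apply: (degenerate_equivalent uG uH).
by apply: eq_degenerate D; elim/ord3_ind.
Qed.

Lemma degenerate_swap01 A B C :
  degenerate (slices3 B A C) -> degenerate (slices3 A B C).
Proof.
move=> D; apply: (@degenerate_mx3 (mx3 (rv3 0 1 0) (rv3 1 0 0) (rv3 0 0 1))).
  have [[l1 l2 l3] [l4 l5 l6]] := lift_ord3.
  rewrite det_mx3 !minorsE !(l1, l2, l3, l4, l5, l6) !mx3E !rv3E.
  by rewrite (_ : _ + _ = -1) ?oppr_eq0 ?oner_eq0 //; ring.
by rewrite !mx3E !rv3E !scale0r !scale1r !addr0 !add0r.
Qed.

Lemma degenerate_swap12 A B C :
  degenerate (slices3 A C B) -> degenerate (slices3 A B C).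
Proof.
move=> D; apply: (@degenerate_mx3 (mx3 (rv3 1 0 0) (rv3 0 0 1) (rv3 0 1 0))).
  have [[l1 l2 l3] [l4 l5 l6]] := lift_ord3.
  rewrite det_mx3 !minorsE !(l1, l2, l3, l4, l5, l6) !mx3E !rv3E.
  by rewrite (_ : _ + _ = -1) ?oppr_eq0 ?oner_eq0 //; ring.
by rewrite !mx3E !rv3E !scale0r !scale1r !addr0 !add0r.
Qed.

Lemma degenerate_rv3 A B C (a b c y0 y1 y2 z0 z1 z2 : K) :
  [|| a != 0, b != 0 | c != 0] -> [|| y0 != 0, y1 != 0 | y2 != 0] ->
  [|| z0 != 0, z1 != 0 | z2 != 0] ->
  (forall j, y0 * (a * A o0 j + b * B o0 j + c * C o0 j)
    + y1 * (a * A o1 j + b * B o1 j + c * C o1 j)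
    + y2 * (a * A o2 j + b * B o2 j + c * C o2 j) = 0) ->
  (forall i, (a * A i o0 + b * B i o0 + c * C i o0) * z0
    + (a * A i o1 + b * B i o1 + c * C i o1) * z1
    + (a * A i o2 + b * B i o2 + c * C i o2) * z2 = 0) ->
  (forall M, [\/ M = A, M = B | M = C] ->
     (y0 * M o0 o0 + y1 * M o1 o0 + y2 * M o2 o0) * z0
   + (y0 * M o0 o1 + y1 * M o1 o1 + y2 * M o2 o1) * z1
   + (y0 * M o0 o2 + y1 * M o1 o2 + y2 * M o2 o2) * z2 = 0) ->
  degenerate (slices3 A B C).
Proof.
move=> nx ny nz e1 e2 e3; exists (rv3 a b c), (rv3 y0 y1 y2), (rv3 z0 z1 z2).
split; first by split; exact: rv3_neq0.
rewrite big_ord3 !rv3E /=; split.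
- by apply/rowP => j; rewrite !mxE big_ord3 !mxE /= e1.
- by apply/colP => i; rewrite !mxE big_ord3 !mxE /= e2.
- move=> k; apply/matrixP=> i j; rewrite !mxE big_ord3 !mxE !big_ord3 !ord1 !rv3E.
  by apply: e3; move: k; elim/ord3_ind; [constructor 1|constructor 2|constructor 3].
Qed.

End Degenerate.

(** * The three normal forms of a relation between minors *)

Section Core.
Variable K : numClosedFieldType.
Implicit Types (A B C D P G H : 'M[K]_3).

Lemma binary_quadratic_root (a b c : K) :
  exists u v, ((u != 0) || (v != 0)) /\ a * u ^+ 2 + b * (u * v) + c * v ^+ 2 = 0.
Proof.
have [a0|a0] := eqVneq a 0.
  by exists 1, 0; rewrite oner_eq0 a0; split=> //; ring.
pose s := sqrtC (b ^+ 2 - 4%:R * a * c).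
have s2 : s ^+ 2 = b ^+ 2 - 4%:R * a * c by rewrite sqrtCK.
exists ((s - b) / (2%:R * a)), 1; rewrite oner_eq0 orbT; split=> //.
have -> : a * ((s - b) / (2%:R * a)) ^+ 2 + b * ((s - b) / (2%:R * a) * 1) + c * 1 ^+ 2
  = (s ^+ 2 - (b ^+ 2 - 4%:R * a * c)) / (4%:R * a).
  by field.
by rewrite s2 subrr mul0r.
Qed.

(** For fixed (u, v) two linear forms in (w, t) remain. They share a nontrivial zero when their 2 x
    2 determinant vanishes, and this determinant is a binary quadratic form in (u, v). *)
Lemma bilinear_pair_root (p q r s p' q' r' s' : K) :
  exists u v w t, [/\ (u != 0) || (v != 0), (w != 0) || (t != 0),
    (u * p + v * r) * w + (u * q + v * s) * t = 0
    & (u * p' + v * r') * w + (u * q' + v * s') * t = 0].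
Proof.
have [u [v [uv e]]] := binary_quadratic_root (p * q' - q * p')
  (p * s' + r * q' - q * r' - s * p') (r * s' - s * r').
pose a := u * p + v * r; pose b := u * q + v * s.
pose a' := u * p' + v * r'; pose b' := u * q' + v * s'.
have e' : a * b' = b * a'.
  apply/eqP; rewrite -subr_eq0 -[X in _ == X]e; apply/eqP.
  by rewrite /a /b /a' /b'; ring.
have [ab|] := boolP ((a != 0) || (b != 0)).
  exists u, v, (- b), a; split=> //; rewrite ?oppr_eq0 1?orbC // -/a -/b -/a' -/b'; first by ring.
  by apply/eqP; rewrite mulrN addrC subr_eq0 mulrC e' mulrC; apply/eqP; ring.
rewrite negb_or !negbK => /andP[/eqP a0 /eqP b0].
have [ab|] := boolP ((a' != 0) || (b' != 0)).
  exists u, v, (- b'), a'; split=> //; rewrite ?oppr_eq0 1?orbC // -/a -/b -/a' -/b'; last by ring.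
  by rewrite a0 b0; ring.
rewrite negb_or !negbK => /andP[/eqP a0' /eqP b0'].
by exists u, v, 1, 0; rewrite -/a -/b -/a' -/b' a0 b0 a0' b0' oner_eq0; split=> //; ring.
Qed.

(** A row (u, v) is an eigenvector when its wedge with its image vanishes; that wedge is the
    quadratic form $q u^2 + (s - p) u v - r v^2$. *)
Lemma left_eigenvector2 (p q r s : K) :
  exists l u v, [/\ (u != 0) || (v != 0), u * p + v * r = l * u & u * q + v * s = l * v].
Proof.
have [u [v [uv e]]] := binary_quadratic_root q (s - p) (- r).
have [u0|u0] := eqVneq u 0.
  have v0 : v != 0 by move: uv; rewrite u0 eqxx.
  exists s, u, v; split=> //; last by rewrite u0; ring.
  have /eqP : r * v ^+ 2 = 0 by rewrite -[RHS]oppr0 -e u0; ring.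
  by rewrite mulf_eq0 expf_eq0 (negPf v0) andbF orbF u0 => /eqP ->; ring.
exists ((u * p + v * r) / u), u, v; split=> //; first by rewrite mulfVK.
apply: (mulfI u0); apply/eqP; rewrite -subr_eq0 -[X in _ == X]e; apply/eqP.
by field.
Qed.

Lemma rank_normal_form A : exists G H r,
  [/\ G \in unitmx, H \in unitmx & G *m A *m H = pid_mx r].
Proof.
exists (invmx (col_ebase A)), (invmx (row_ebase A)), (\rank A).
rewrite !unitmx_inv col_ebase_unit row_ebase_unit; split=> //.
rewrite -{2}[A]mulmx_ebase -!mulmxA mulKmx ?col_ebase_unit //.
by rewrite mulmxV ?row_ebase_unit // mulmx1.
Qed.

Lemma minorsD_equivalent G H A B :
  minorsD (G *m A *m H) (G *m B *m H) = minors G *m minorsD A B *m minors H.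
Proof.
by rewrite /minorsD -mulmxDl -mulmxDr !minorsM !mulmxBr !mulmxBl.
Qed.

Lemma minors_pid_eq0 r : minors (pid_mx r : 'M[K]_3) = 0 -> (r <= 1)%N.
Proof.
have [[l1 l2 l3] [l4 l5 l6]] := lift_ord3.
move=> /matrixP /(_ o2 o2); rewrite minorsE l5 l6 !mxE /=.
by case: r => [|[|r]] //= /eqP; rewrite mulr0 subr0 mulr1 oner_eq0.
Qed.

(** A has rank at most 1, so in normal form it is killed on both sides by vectors supported on the
    last two coordinates. Taking A itself as the slice of x, it remains to find such y and z with y
    B z = y C z = 0: a pair of bilinear equations on the lower 2 x 2 blocks. *)
Lemma degenerate_minors_eq0 A B C : minors A = 0 -> degenerate (slices3 A B C).
Proof.
have [G [H [r [uG uH]]]] := rank_normal_form A.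
move=> eA mA; apply: (degenerate_equivalent3 uG uH).
have r1 : (r <= 1)%N by apply: minors_pid_eq0; rewrite -eA !minorsM mA mulmx0 mul0mx.
set B' := G *m B *m H; set C' := G *m C *m H; rewrite eA.
have [u [v [w [t [uv wt e1 e2]]]]] := bilinear_pair_root
  (B' o1 o1) (B' o1 o2) (B' o2 o1) (B' o2 o2) (C' o1 o1) (C' o1 o2) (C' o2 o1) (C' o2 o2).
apply: (@degenerate_rv3 _ _ _ _ 1 0 0 0 u v 0 w t); rewrite ?oner_eq0 ?uv ?wt ?orbT //.
- by elim/ord3_ind; rewrite !mxE /=; case: r r1 {eA} => [|[|]] //= _; ring.
- by elim/ord3_ind; rewrite !mxE /=; case: r r1 {eA} => [|[|]] //= _; ring.
- move=> M [] ->.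
  + by rewrite !mxE /=; case: r r1 {eA} => [|[|]] //= _; ring.
  + by rewrite mulr0 !mul0r !add0r.
  + by rewrite mulr0 !mul0r !add0r.
Qed.

Lemma minors_pid_le1 r : (r <= 1)%N -> minors (pid_mx r : 'M[K]_3) = 0.
Proof.
have [[l1 l2 l3] [l4 l5 l6]] := lift_ord3.
move=> r1; apply/matrixP; elim/ord3_ind; elim/ord3_ind;
  rewrite minorsE !(l1, l2, l3, l4, l5, l6) !mxE /=;
  by case: r r1 => [|[|]] //= _; ring.
Qed.

(** Put A in normal form. If its rank is 3, the off-diagonal entries of B and the pairwise sums of
    its diagonal entries vanish, so B = 0. If it is 2, only a traceless 2 x 2 block of B survives.
    Either way the pencil of A and B contains a member of rank at most 1. *)
Lemma degenerate_minorsD_eq0 A B C :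
  minorsD A B = 0 -> degenerate (slices3 A B C).
Proof.
have [G [H [r [uG uH eA]]]] := rank_normal_form A.
move=> mAB; apply: (degenerate_equivalent3 uG uH).
have := minorsD_equivalent G H A B; rewrite mAB mulmx0 mul0mx.
set B' := G *m B *m H; set C' := G *m C *m H; rewrite eA => mB; clearbody B' C'.
have [r1|r1] := leqP r 1.
  by apply: degenerate_minors_eq0; apply: minors_pid_le1.
have [[l1 l2 l3] [l4 l5 l6]] := lift_ord3.
have e a b : minorsD (pid_mx r) B' a b = 0 by rewrite mB mxE.
have := (e o0 o0, e o0 o1, e o0 o2).
have := (e o1 o0, e o1 o1, e o1 o2).
have := (e o2 o0, e o2 o1, e o2 o2).
rewrite !minorsDE !(l1, l2, l3, l4, l5, l6).
set E := pid_mx r.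
have [E00 E11 E22] : [/\ E o0 o0 = 1, E o1 o1 = 1 & E o2 o2 = (2 < r)%:R].
  by rewrite !mxE /=; case: r r1 {E eA mB e} => [|[|]].
have [E01 E02 E12] : [/\ E o0 o1 = 0, E o0 o2 = 0 & E o1 o2 = 0] by rewrite !mxE.
have [E10 E20 E21] : [/\ E o1 o0 = 0, E o2 o0 = 0 & E o2 o1 = 0] by rewrite !mxE.
rewrite !(E00, E01, E02, E10, E11, E12, E20, E21, E22).
rewrite !(mul0r, mulr0, mul1r, mulr1, subr0, sub0r, add0r, addr0).
have half0 (x y z : K) : x + y = 0 -> x + z = 0 -> y + z = 0 -> x = 0.
  move=> xy xz yz; apply/eqP; have : 2%:R * x = 0.
    have -> : 2%:R * x = (x + y) + (x + z) - (y + z) by ring.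
    by rewrite xy xz yz subr0 addr0.
  by move=> /eqP; rewrite mulf_eq0 pnatr_eq0.
case: (ltnP 2 r) E22 => r2 /= E22;
  rewrite ?(mul0r, mulr0, mulr1, mul1r, oppr0, sub0r, add0r, addr0).
  move=> [[/eqP]]; rewrite oppr_eq0 => /eqP h22 h21 h20 [[h12 h11] h10] [[h02 h01] /eqP].
  rewrite oppr_eq0 => /eqP h00.
  have b0 : B' o0 o0 = 0 by apply: (half0 _ (B' o1 o1) (B' o2 o2)); rewrite // addrC.
  move: h20 h11; rewrite b0 !addr0 => b1 b2.
  apply: degenerate_swap01; apply: degenerate_minors_eq0.
  apply/matrixP; elim/ord3_ind; elim/ord3_ind;
    by rewrite minorsE !(l1, l2, l3, l4, l5, l6) [RHS]mxE
      ?(h22, h21, h12, h10, h01, h00, b0, b1, b2); ring.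
move=> [[/eqP]]; rewrite oppr_eq0 => /eqP h22 h21 h20 [[h12 h11] h10] [[h02 h01] /eqP].
rewrite oppr_eq0 => /eqP h00.
(* B is now a traceless 2 x 2 block with eigenvalue l, so B - l A has rank <= 1. *)
pose l := sqrtC (B' o0 o0 ^+ 2 + B' o0 o1 * B' o1 o0).
have l2E : l ^+ 2 = B' o0 o0 ^+ 2 + B' o0 o1 * B' o1 o0 by rewrite sqrtCK.
have b1 : B' o1 o1 = - B' o0 o0 by apply/eqP; rewrite -addr_eq0 h20.
apply: (@degenerate_mx3 _ (mx3 (rv3 (- l) 1 0) (rv3 1 0 0) (rv3 0 0 1))).
  rewrite det_mx3 !minorsE !(l1, l2, l3, l4, l5, l6) !mx3E !rv3E.
  by rewrite (_ : _ + _ = -1) ?oppr_eq0 ?oner_eq0 //; ring.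
rewrite !mx3E !rv3E !scale0r !scale1r !addr0 !add0r.
apply: degenerate_minors_eq0.
have sE i j : (- l *: E + B') i j = - l * E i j + B' i j by rewrite mxE [X in X + _]mxE.
apply/matrixP; elim/ord3_ind; elim/ord3_ind;
  rewrite minorsE !(l1, l2, l3, l4, l5, l6) !sE [RHS]mxE
    ?(E00, E01, E02, E10, E11, E12, E20, E21, E22, h22, h21, h11, h10, h00, b1); try ring.
rewrite -[RHS](subrr (l ^+ 2)) {2}l2E; ring.
Qed.

(** Outside rank at most 1, A becomes diag(1, 1, 0), with both kernels spanned by the last basis
    vector. That vector serves as z; the choice of x and y depends on whether the last diagonal
    entry of C vanishes. *)
Lemma degenerate_hyperbolic_singular A B C : \det A = 0 ->
  minorsD A B + minors C = 0 -> degenerate (slices3 A B C).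
Proof.
move=> dA mAB.
have [G [H [r [uG uH eA]]]] := rank_normal_form A.
apply: (degenerate_equivalent3 uG uH).
have : minorsD (G *m A *m H) (G *m B *m H) + minors (G *m C *m H) = 0.
  by rewrite minorsD_equivalent !minorsM -mulmxDl -mulmxDr mAB mulmx0 mul0mx.
have : \det (G *m A *m H) = 0 by rewrite !det_mulmx dA mulr0 mul0r.
set B' := G *m B *m H; set C' := G *m C *m H; rewrite eA => dE mB; clearbody B' C'.
have [r1|r1] := leqP r 1.
  by apply: degenerate_minors_eq0; apply: minors_pid_le1.
have [[l1 l2 l3] [l4 l5 l6]] := lift_ord3.
have e a b : minorsD (pid_mx r) B' a b + minors C' a b = 0.
  by have /matrixP /(_ a b) := mB; rewrite mxE => ->; rewrite mxE.
have := (e o0 o0, e o0 o1, e o0 o2).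
have := (e o1 o0, e o1 o1, e o1 o2).
have := (e o2 o0, e o2 o1, e o2 o2).
rewrite !minorsDE !minorsE !(l1, l2, l3, l4, l5, l6).
set E := pid_mx r.
have [E00 E11] : E o0 o0 = 1 /\ E o1 o1 = 1.
  by rewrite !mxE /=; case: r r1 {E eA mB e dE} => [|[|]].
have [E01 E02 E12] : [/\ E o0 o1 = 0, E o0 o2 = 0 & E o1 o2 = 0] by rewrite !mxE.
have [E10 E20 E21] : [/\ E o1 o0 = 0, E o2 o0 = 0 & E o2 o1 = 0] by rewrite !mxE.
have E22 : E o2 o2 = 0.
  move: dE; rewrite det_mx3 !minorsE !(l1, l2, l3, l4, l5, l6) -/E.
  rewrite E00 E11 E01 E02 E12 E10 E20 E21 => <-; ring.
rewrite !(E00, E01, E02, E10, E11, E12, E20, E21, E22).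
rewrite !(mul0r, mulr0, mul1r, mulr1, subr0, sub0r, add0r, addr0, oppr0).
(* As in the preceding proof, the second digit counts columns backwards: [h20] is entry (2, 2) of
   the relation and [h22] is entry (2, 0). *)
move=> [[h22 h21] h20] [[h12 h11] h10] [[h02 h01] h00].
have [g0|g0] := eqVneq (C' o2 o2) 0.
  (* With $C_{22} = 0$, entries (1, 1), (0, 0) and (1, 0) read $B_{22} = C_{02} C_{20}$, $B_{22} =
     C_{12} C_{21}$ and $C_{02} C_{21} = 0$, hence $B_{22}^2 = 0$. *)
  have b0 : B' o2 o2 = 0.
    move: h11 h02 h12; rewrite g0 !mulr0 !sub0r => /eqP; rewrite subr_eq0 => /eqP b1.
    move=> /eqP; rewrite subr_eq0 => /eqP b2 /eqP; rewrite oppr_eq0 => /eqP c0.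
    apply/eqP; rewrite -sqrf_eq0 expr2 {1}b1 b2.
    by rewrite [C' o1 o2 * _]mulrC mulrACA c0 mul0r.
  apply: (@degenerate_rv3 _ _ _ _ 1 0 0 0 0 1 0 0 1); rewrite ?oner_eq0 ?orbT //.
  - by elim/ord3_ind; rewrite ?(E20, E21, E22); ring.
  - by elim/ord3_ind; rewrite ?(E02, E12, E22); ring.
  - by move=> M [] ->; rewrite ?E22 ?b0 ?g0; ring.
pose g := C' o2 o2; pose b := B' o2 o2.
(* Laplace expansion with alien cofactors: the last column of C paired with the signed minors
   omitting column 0 gives zero, and the relation turns these minors into entries of B. For [k1] the
   omitted column is 1. *)
have k0 : g * B' o0 o2 = b * C' o0 o2.
  apply/eqP; rewrite -subr_eq0 (_ : _ - _ =
    - g * (- B' o0 o2 + (C' o0 o1 * C' o1 o2 - C' o0 o2 * C' o1 o1))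
    - C' o0 o2 * (B' o2 o2 + (C' o1 o1 * C' o2 o2 - C' o1 o2 * C' o2 o1))
    + C' o1 o2 * (C' o0 o1 * C' o2 o2 - C' o0 o2 * C' o2 o1)); last by rewrite /g /b; ring.
  by rewrite h22 h02 h12 !mulr0 subr0 addr0.
have k1 : g * B' o1 o2 = b * C' o1 o2.
  apply/eqP; rewrite -subr_eq0 (_ : _ - _ =
    g * (B' o1 o2 + (C' o0 o0 * C' o1 o2 - C' o0 o2 * C' o1 o0))
    - C' o1 o2 * (B' o2 o2 + (C' o0 o0 * C' o2 o2 - C' o0 o2 * C' o2 o0))
    + C' o0 o2 * (C' o1 o0 * C' o2 o2 - C' o1 o2 * C' o2 o0)); last by rewrite /g /b; ring.
  by rewrite h21 h11 h01 !mulr0 subr0 addr0.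
(* By k0 and k1, clearing the last row and column of C with its pivot g also
   clears those of B up to the last entry; the 2 x 2 block of g B - b C that
   remains has the entries below, and an eigenvector of it gives the triple. *)
have [l [u [v [uv e0 e1]]]] := left_eigenvector2
  (g * B' o0 o0 - b * C' o0 o0 - C' o0 o2 / g * (g * B' o2 o0 - b * C' o2 o0))
  (g * B' o0 o1 - b * C' o0 o1 - C' o0 o2 / g * (g * B' o2 o1 - b * C' o2 o1))
  (g * B' o1 o0 - b * C' o1 o0 - C' o1 o2 / g * (g * B' o2 o0 - b * C' o2 o0))
  (g * B' o1 o1 - b * C' o1 o1 - C' o1 o2 / g * (g * B' o2 o1 - b * C' o2 o1)).
(* The slice of x is g B - b C - l A, whose last column is zero by [k0] and [k1]. The last entry of
   y is chosen so that y C z = 0; then y B z = 0 too, because g B z = b C z. The eigenvector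
   equations say that y annihilates the first two columns of the slice. *)
apply: (@degenerate_rv3 _ _ _ _ (- l) g (- b) u v (- (C' o0 o2 * u + C' o1 o2 * v) / g) 0 0 1).
- by rewrite g0 orbT.
- by rewrite orbA uv.
- by rewrite oner_eq0 !orbT.
- elim/ord3_ind; rewrite ?(E00, E01, E02, E10, E11, E12, E20, E21, E22).
  + by rewrite -[RHS](subrr (l * u)) -{1}e0; field.
  + by rewrite -[RHS](subrr (l * v)) -{1}e1; field.
  + by rewrite !mulr0 !add0r k0 k1 -/b -/g; ring.
- elim/ord3_ind; rewrite ?(E02, E12, E22) ?k0 ?k1 -/b -/g; ring.
- move=> M [] ->; rewrite ?(E02, E12, E22); first by ring.
  + rewrite -/b; apply: (mulfI g0); rewrite -/g.
    transitivity (u * (g * B' o0 o2) + v * (g * B' o1 o2) - (C' o0 o2 * u + C' o1 o2 * v) * b).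
      by field.
    by rewrite k0 k1; ring.
  + by rewrite -/g; field.
Qed.

Lemma minorsDC A B : minorsD A B = minorsD B A.
Proof. by rewrite /minorsD [B + A]addrC [LHS]addrAC. Qed.

Lemma degenerate_hyperbolic A B C :
  minorsD A B + minors C = 0 -> degenerate (slices3 A B C).
Proof.
have [[l1 l2 l3] [l4 l5 l6]] := lift_ord3.
move=> mAB; have [dB|dB] := eqVneq (\det B) 0.
  apply: degenerate_swap01; apply: degenerate_hyperbolic_singular => //.
  by rewrite minorsDC.
(* (A, B, C) |-> (A - t^2/2 B + t C, B, C - t B) preserves minorsD A B + minors C. *)
pose Mt (t : K) : 'M[K]_3 := 1 *: A + (- (t ^+ 2 / 2%:R)) *: B + t *: C.
have [t rt] : exists t, \det (Mt t) = 0.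
  pose Mp : 'M[{poly K}]_3 := \matrix_(i, j)
    ((A i j)%:P - (2%:R^-1 * B i j) *: 'X^2 + C i j *: 'X).
  have Mp_t t : (\det Mp).[t] = \det (Mt t).
    rewrite -horner_evalE -det_map_mx; congr (\det _).
    apply/matrixP => i j; rewrite !mxE /= horner_evalE !hornerE /=.
    by ring.
  have /closed_rootP [t /rootP rt] : size (\det Mp) != 1%N.
    apply/negP => /size_poly1P [c c0 Ec].
    have {}Ec t : \det (Mt t) = c by rewrite -Mp_t Ec hornerC.
    have MtE (t : K) i j : Mt t i j = A i j - t ^+ 2 / 2%:R * B i j + t * C i j.
      by rewrite !mxE mul1r mulNr.
    (* The leading coefficient of the sextic det (Mt t) is - det B / 8; its sixth
       finite difference, 720 times that, vanishes if det (Mt t) is constant. *)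
    have : 90%:R * \det B = 0.
      transitivity (- (\det (Mt 0) - 6%:R * \det (Mt 1) + 15%:R * \det (Mt 2%:R)
        - 20%:R * \det (Mt 3%:R) + 15%:R * \det (Mt 4%:R) - 6%:R * \det (Mt 5%:R)
        + \det (Mt 6%:R))); last by rewrite !Ec; ring.
      rewrite !det_mx3 !minorsE !(l1, l2, l3, l4, l5, l6) !MtE.
      by field.
    by move=> /eqP; rewrite mulf_eq0 pnatr_eq0 (negPf dB).
  by exists t; rewrite -Mp_t.
apply: (@degenerate_mx3 _ (mx3 (rv3 1 (- (t ^+ 2 / 2%:R)) t) (rv3 0 1 0) (rv3 0 (- t) 1))).
  rewrite det_mx3 !minorsE !(l1, l2, l3, l4, l5, l6) !mx3E !rv3E.
  by rewrite (_ : _ + _ = 1) ?oner_eq0 //; ring.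
rewrite !mx3E !rv3E !scale0r !scale1r !addr0 !add0r; apply: degenerate_hyperbolic_singular.
  by rewrite -[RHS]rt /Mt scale1r.
rewrite -[RHS]mAB; apply/matrixP => a b.
by rewrite [LHS]mxDE [RHS]mxDE !minorsDE !minorsE !mxDE !mxZE; field.
Qed.

End Core.

(** * Diagonalization of symmetric matrices by congruence *)

(** A basis vector works if some diagonal entry is nonzero. Otherwise the form takes the value $2
    Q_{ij}$ at $e_i + e_j$. *)
Lemma symmetric_anisotropic (F : numFieldType) n (Q : 'M[F]_n) :
  Q^T = Q -> Q != 0 -> exists v : 'rV_n, (v *m Q *m v^T) 0 0 != 0.
Proof.
move=> sQ nzQ.
have bE i j : (delta_mx 0 i *m Q *m (delta_mx 0 j)^T : 'M_1) 0 0 = Q i j.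
  by rewrite trmx_delta -rowE -colE !mxE.
have [i di|ndiag] := pickP (fun i => Q i i != 0).
  by exists (delta_mx 0 i); rewrite bE.
have [i /existsP [j nij]|Q0] := pickP (fun i => [exists j, Q i j != 0]); last first.
  case/eqP: nzQ; apply/matrixP => i j; rewrite mxE.
  by have /negbT := Q0 i; rewrite negb_exists => /forallP /(_ j); rewrite negbK => /eqP.
exists (delta_mx 0 i + delta_mx 0 j).
have Qji : Q j i = Q i j by rewrite -[in LHS]sQ mxE.
have Qd k : Q k k = 0 by apply/eqP; have := ndiag k; rewrite /= => /negbFE.
rewrite linearD /= !mulmxDl !mulmxDr !mxDE !bE !Qd Qji add0r addr0.
by rewrite -mulr2n mulrn_eq0.
Qed.

(** Lagrange reduction: move an anisotropic vector to the first place of a basis, complete the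
    square there, and recurse on the rest. *)
Lemma symmetric_diagonalizable (F : numFieldType) n (Q : 'M[F]_n) : Q^T = Q ->
  exists (P : 'M_n) (d : 'rV_n), P \in unitmx /\ Q = P^T *m diag_mx d *m P.
Proof.
elim: n Q => [|n IHn] Q sQ.
  by exists 1%:M, 0; rewrite unitmx1; split=> //; apply/matrixP => -[].
have [->|nzQ] := eqVneq Q 0.
  by exists 1%:M, 0; rewrite unitmx1; split=> //; rewrite linear0 mulmx0 mul0mx.
have [v nv] := symmetric_anisotropic sQ nzQ.
(* The first row of this invertible matrix spans a line containing v, so the corner of [Q'] is
   nonzero. *)
pose W : 'M_(1 + n) := row_ebase v.
have uW : W \in unitmx by exact: row_ebase_unit.
pose Q' : 'M_(1 + n) := W *m Q *m W^T.
have sQ' : Q'^T = Q' by rewrite !trmx_mul trmxK sQ mulmxA.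
pose a := Q' 0 0.
have a0 : a != 0.
  have [k vE] : exists k, v = k *: row 0 W.
    exists (col_ebase v 0 0 * (0 < \rank v)%:R).
    rewrite -{1}[v]mulmx_ebase {1}[col_ebase v]mx11_scalar mul_scalar_mx -scalemxAl -scalerA.
    congr (_ *: _); rewrite rowE scalemxAl; congr (_ *m _).
    by apply/matrixP => i j; rewrite !mxE !ord1 /= eq_sym; case: (\rank v) => [|r] /=;
      rewrite ?andbF ?mul0r ?mul1r //; case: j => [[|j] ltj].
  apply: contraNneq nv => a0; rewrite vE linearZ /= -!scalemxAl -scalemxAr.
  have -> : row 0 W *m Q *m (row 0 W)^T = a%:M.
    apply/matrixP => i j; rewrite -row_mul !ord1 !mxE /= mulr1n /a /Q' [RHS]mxE.
    by apply: eq_bigr => k' _; rewrite !mxE.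
  by rewrite a0 !mxE mul0rn !mulr0.
have QE : Q = invmx W *m Q' *m invmx W^T.
  by rewrite /Q' !mulmxA mulVmx // mul1mx mulmxK ?unitmx_tr.
clearbody Q'.
pose b : 'rV_n := ursubmx Q'.
have Q'E : Q' = block_mx a%:M b b^T (drsubmx Q').
  rewrite -[LHS]submxK; congr block_mx.
  - by rewrite [LHS]mx11_scalar !mxE; congr (Q' _ _)%:M; apply: val_inj.
  - by rewrite -[in LHS]sQ' -trmx_ursub.
(* The Schur complement of the corner a, that is, what remains after completing the square. *)
pose D := drsubmx Q' - a^-1 *: (b^T *m b).
have sD : D^T = D by rewrite linearB linearZ /= trmx_mul trmxK trmx_drsub sQ'.
have [P1 [d [uP1 DE]]] := IHn D sD.
pose R : 'M_(1 + n) := block_mx 1%:M (a^-1 *: b) 0 P1.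
have uR : R \in unitmx.
  by rewrite unitmxE det_ublock det1 mul1r -unitmxE.
exists (R *m invmx W^T), (row_mx a%:M d); split.
  by rewrite unitmx_mul uR unitmx_inv unitmx_tr.
rewrite QE trmx_mul trmx_inv trmxK -!mulmxA; congr (_ *m _); rewrite !mulmxA.
congr (_ *m _).
have diag_a : diag_mx (a%:M : 'rV_1) = a%:M.
  by apply/matrixP => i j; rewrite !ord1 !mxE.
have RE : R^T *m diag_mx (row_mx a%:M d) *m R = block_mx a%:M b b^T (drsubmx Q').
  rewrite /R tr_block_mx diag_mx_row !mulmx_block trmx1 trmx0 diag_a.
  rewrite !(mul0mx, mulmx0, mul1mx, mulmx1, addr0, add0r) -DE.
  rewrite mul_scalar_mx scalerA mulfV // scale1r linearZ /=.
  by rewrite mul_mx_scalar scalerA mulfV // scale1r -scalemxAr /D addrC subrK.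
by rewrite [LHS]Q'E -RE.
Qed.

(** * Quadratic relations between the minors force degeneracy *)

Local Notation s0 := (@Ordinal 6 0 isT).
Local Notation s1 := (@Ordinal 6 1 isT).
Local Notation s2 := (@Ordinal 6 2 isT).
Local Notation s3 := (@Ordinal 6 3 isT).
Local Notation s4 := (@Ordinal 6 4 isT).
Local Notation s5 := (@Ordinal 6 5 isT).

Lemma ord6_ind (P : 'I_6 -> Prop) :
  P s0 -> P s1 -> P s2 -> P s3 -> P s4 -> P s5 -> forall i, P i.
Proof.
move=> P0 P1 P2 P3 P4 P5 [m ltm].
by move: m ltm; do 6?[case=> [|]]; [| | | | | |by []] => ltm;
  [have -> : Ordinal ltm = s0 by apply: val_inj
  |have -> : Ordinal ltm = s1 by apply: val_inj
  |have -> : Ordinal ltm = s2 by apply: val_inj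
  |have -> : Ordinal ltm = s3 by apply: val_inj
  |have -> : Ordinal ltm = s4 by apply: val_inj
  |have -> : Ordinal ltm = s5 by apply: val_inj].
Qed.

Lemma big_ord6 (V : nmodType) (F : 'I_6 -> V) :
  \sum_(i < 6) F i = F s0 + F s1 + F s2 + F s3 + F s4 + F s5.
Proof.
rewrite 6!big_ord_recl big_ord0 addr0 !addrA.
by congr (F _ + F _ + F _ + F _ + F _ + F _); apply: val_inj.
Qed.

Section Relations.
Variable K : numClosedFieldType.
Implicit Types (A B C P Q : 'M[K]_3) (S : 'I_3 -> 'M[K]_3).

(** With $p^2 = d_0$ and $q^2 = -d_1$, the first two terms form a hyperbolic plane: polarizing
    [minors] at pA + qB and pA - qB gives twice their sum. *)
Lemma degenerate_diag2 (d0 d1 d2 : K) A B C : d0 != 0 -> d1 != 0 ->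
  d0 *: minors A + d1 *: minors B + d2 *: minors C = 0 ->
  degenerate (slices3 A B C).
Proof.
have [[l1 l2 l3] [l4 l5 l6]] := lift_ord3.
move=> nz0 nz1 rel.
have n2 : 2%:R != 0 :> K by rewrite pnatr_eq0.
pose p := sqrtC d0; pose q := sqrtC (- d1).
(* The square root of $2 d_2$ matches the factor 2 of the polarization; the value 1 for $d_2 = 0$
   keeps the change of slices invertible. *)
pose r := if d2 == 0 then 1 else sqrtC (2%:R * d2).
have pp : p * p = d0 by rewrite -expr2 sqrtCK.
have qq : q * q = - d1 by rewrite -expr2 sqrtCK.
have p0 : p != 0 by rewrite sqrtC_eq0.
have q0 : q != 0 by rewrite sqrtC_eq0 oppr_eq0.
have r0 : r != 0.
  by rewrite /r; case: (eqVneq d2 0) => [_|z]; rewrite ?oner_eq0 // sqrtC_eq0 mulf_neq0.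
apply: (@degenerate_mx3 _ (mx3 (rv3 p q 0) (rv3 p (- q) 0) (rv3 0 0 r))).
  rewrite det_mx3 !minorsE !(l1, l2, l3, l4, l5, l6) !mx3E !rv3E.
  have -> : p * (- q * r - 0 * 0) - q * (p * r - 0 * 0) + 0 * (p * 0 - - q * 0)
    = - (2%:R * p * q * r) by ring.
  by rewrite oppr_eq0 !mulf_neq0.
rewrite !mx3E !rv3E !scale0r !addr0 !add0r.
have mE : minorsD (p *: A + q *: B) (p *: A + - q *: B)
    = 2%:R *: (d0 *: minors A + d1 *: minors B).
  apply/matrixP => a b; rewrite minorsDE [RHS]mxZE [X in _ * X]mxDE !mxZE !mxDE !mxZE.
  by rewrite -[d1]opprK -pp -qq !minorsE; ring.
have [z|nz] := eqVneq d2 0.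
  apply: degenerate_minorsD_eq0; rewrite mE; move: rel.
  by rewrite z scale0r addr0 => ->; rewrite scaler0.
apply: degenerate_hyperbolic; rewrite mE.
have -> : minors (r *: C) = 2%:R *: (d2 *: minors C).
  have rr : r * r = 2%:R * d2 by rewrite -expr2 /r (negPf nz) sqrtCK.
  apply/matrixP => a b; rewrite [RHS]mxZE [X in _ * X]mxZE !minorsE !mxZE.
  by rewrite [RHS]mulrA -rr; ring.
by rewrite -scalerDr rel scaler0.
Qed.

Lemma degenerate_diag (d : 'rV[K]_3) A B C : d != 0 ->
  d 0 o0 *: minors A + d 0 o1 *: minors B + d 0 o2 *: minors C = 0 ->
  degenerate (slices3 A B C).
Proof.
move=> nzd; have [d0|d0] := eqVneq (d 0 o0) 0; last first.
  have [d1|d1] := eqVneq (d 0 o1) 0; last exact: degenerate_diag2.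
  have [d2|d2] := eqVneq (d 0 o2) 0.
    rewrite d1 d2 !scale0r !addr0 => /eqP; rewrite scaler_eq0 (negPf d0) => /eqP.
    exact: degenerate_minors_eq0.
  move=> rel; apply: degenerate_swap12; apply: (degenerate_diag2 d0 d2).
  by rewrite -[RHS]rel addrAC.
rewrite d0 scale0r add0r.
have [d1|d1] := eqVneq (d 0 o1) 0.
  rewrite d1 scale0r add0r => /eqP; rewrite scaler_eq0 => /orP[/eqP d2|/eqP mC].
    by case/eqP: nzd; apply/rowP; elim/ord3_ind; rewrite mxE.
  by apply: degenerate_swap12; apply: degenerate_swap01; apply: degenerate_minors_eq0.
have [d2|d2] := eqVneq (d 0 o2) 0.
  rewrite d2 scale0r addr0 => /eqP; rewrite scaler_eq0 (negPf d1) => /eqP mB.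
  by apply: degenerate_swap01; apply: degenerate_minors_eq0.
move=> rel; apply: degenerate_swap01; apply: degenerate_swap12.
by apply: (degenerate_diag2 (d2 := 0) d1 d2); rewrite scale0r addr0.
Qed.

(** If $Q = P^T \mathrm{diag}(d) P$, bilinearity turns the sum into $2 \sum_k d_k$ [minors] $(S'_k)$
    for the slices $S'_k = \sum_c P_{kc} S_c$, which is a diagonal relation. *)
Lemma degenerate_relation S Q : Q^T = Q -> Q != 0 ->
  \sum_i \sum_j Q i j *: minorsD (S i) (S j) = 0 -> degenerate S.
Proof.
move=> sQ nzQ rel.
have [P [d [uP QE]]] := symmetric_diagonalizable sQ.
have nzd : d != 0.
  by apply: contraNneq nzQ => d0; rewrite QE d0 linear0 mulmx0 mul0mx.
apply: (degenerate_recombine uP).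
pose S' k := \sum_c P k c *: S c.
apply: (@eq_degenerate _ (slices3 (S' o0) (S' o1) (S' o2))); first by elim/ord3_ind.
apply: (degenerate_diag nzd).
have n2 : 2%:R != 0 :> K by rewrite pnatr_eq0.
apply: (scalerI n2); rewrite scaler0 -[RHS]rel.
have QijE i j : Q i j = P o0 i * d 0 o0 * P o0 j + P o1 i * d 0 o1 * P o1 j
    + P o2 i * d 0 o2 * P o2 j.
  rewrite QE mul_mx_diag mxE big_ord3 !mxE; ring.
have S'E k i j : S' k i j = P k o0 * S o0 i j + P k o1 * S o1 i j + P k o2 * S o2 i j.
  by rewrite /S' summxE big_ord3 !mxZE.
apply/matrixP => a b; rewrite [LHS]mxZE [X in _ * X]mxDE [X in _ * (X + _)]mxDE !mxZE.
have -> : (\sum_i \sum_j Q i j *: minorsD (S i) (S j)) a b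
    = \sum_i \sum_j Q i j * minorsD (S i) (S j) a b.
  rewrite summxE; apply: eq_bigr => i _; rewrite summxE.
  by apply: eq_bigr => j _; rewrite mxZE.
rewrite !big_ord3 !QijE !minorsDE !minorsE !S'E; ring.
Qed.

(** Row k holds the coefficients, in the minors of $\sum_c x_c S_c$, of the k-th quadratic monomial
    in the order of [veronese_map]. *)
Definition minor_coefs S : 'M[K]_(6, 3 * 3) :=
  \matrix_(k < 6) mxvec (nth 0 [:: minors (S o0); minorsD (S o0) (S o1);
    minorsD (S o0) (S o2); minors (S o1); minorsD (S o1) (S o2);
    minors (S o2)] k).

Lemma minor_coefs_free S : ~ degenerate S -> row_free (minor_coefs S).
Proof.
move=> nd; rewrite -kermx_eq0; apply/rowV0P => q /sub_kermxP rel.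
apply/eqP/negPn/negP => nzq; apply: nd.
have {}rel : q 0 s0 *: minors (S o0) + q 0 s1 *: minorsD (S o0) (S o1)
    + q 0 s2 *: minorsD (S o0) (S o2) + q 0 s3 *: minors (S o1)
    + q 0 s4 *: minorsD (S o1) (S o2) + q 0 s5 *: minors (S o2) = 0.
  apply: (can_inj mxvecK); rewrite linear0 -[RHS]rel mulmx_sum_row big_ord6.
  by rewrite !rowK /= !linearD /= !linearZ.
(* Off-diagonal coefficients are not halved: as [minorsD A A] is twice [minors A], the sum over all
   pairs (i, j) is exactly twice the relation. *)
pose Q := mx3 (rv3 (q 0 s0) (q 0 s1) (q 0 s2))
  (rv3 (q 0 s1) (q 0 s3) (q 0 s4)) (rv3 (q 0 s2) (q 0 s4) (q 0 s5)).
apply: (@degenerate_relation _ Q).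
- by apply/matrixP; elim/ord3_ind; elim/ord3_ind; rewrite mxE !mx3E !rv3E.
- apply: contraNneq nzq => Q0; apply/eqP/rowP.
  have e i j : Q i j = 0 by rewrite Q0 mxE.
  have := (e o0 o0, e o0 o1, e o0 o2, e o1 o1, e o1 o2, e o2 o2).
  rewrite !mx3E !rv3E => -[[[[[q0 q1] q2] q3] q4] q5].
  by elim/ord6_ind; rewrite [RHS]mxE.
- have minorsDxx A : minorsD A A = 2%:R *: minors A.
    by apply/matrixP => a b; rewrite minorsDE [RHS]mxE minorsE; ring.
  rewrite -[RHS](scaler0 _ 2%:R) -[in RHS]rel !big_ord3 !mx3E !rv3E !minorsDxx.
  rewrite (minorsDC (S o1) (S o0)) (minorsDC (S o2) (S o0)) (minorsDC (S o2) (S o1)).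
  move: (minors (S o0)) (minors (S o1)) (minors (S o2)) (minorsD (S o0) (S o1))
    (minorsD (S o0) (S o2)) (minorsD (S o1) (S o2)) => X0 X1 X2 X01 X02 X12.
  by apply/matrixP => a b; rewrite !mxE; ring.
Qed.

End Relations.

(** * The Veronese surface and its injective linear images *)

Section Veronese.
Variable K : fieldType.

Lemma inord3 : (inord 0 = o0) * (inord 1 = o1) * (inord 2 = o2).
Proof. by do !split; apply: val_inj; rewrite /= inordK. Qed.

Lemma veronese_mapE (x : 'rV[K]_3) :
  (veronese_map x 0 s0 = x 0 o0 ^+ 2) * (veronese_map x 0 s1 = x 0 o0 * x 0 o1) *
  (veronese_map x 0 s2 = x 0 o0 * x 0 o2) * (veronese_map x 0 s3 = x 0 o1 ^+ 2) *
  (veronese_map x 0 s4 = x 0 o1 * x 0 o2) * (veronese_map x 0 s5 = x 0 o2 ^+ 2).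
Proof. by rewrite !mxE !inord3. Qed.

Lemma veronese_map_neq0 (x : 'rV[K]_3) : x != 0 -> veronese_map x != 0.
Proof.
apply: contraNneq => v0; apply/eqP/rowP => i; rewrite mxE; apply/eqP.
have e k : veronese_map x 0 k = 0 by rewrite v0 mxE.
move: i; elim/ord3_ind; rewrite -sqrf_eq0; apply/eqP.
- by rewrite -[RHS](e s0) veronese_mapE.
- by rewrite -[RHS](e s3) veronese_mapE.
- by rewrite -[RHS](e s5) veronese_mapE.
Qed.

(** Read v as a symmetric 3 x 3 matrix with some vanishing 2 x 2 minors. A row through a nonzero
    diagonal entry, rescaled by the inverse of that entry, is a preimage; the cases follow the first
    such entry. *)
Lemma veronese_surfaceP (v : 'rV[K]_6) : v != 0 ->
  v 0 s0 * v 0 s3 = v 0 s1 ^+ 2 -> v 0 s0 * v 0 s5 = v 0 s2 ^+ 2 ->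
  v 0 s3 * v 0 s5 = v 0 s4 ^+ 2 -> v 0 s0 * v 0 s4 = v 0 s1 * v 0 s2 ->
  veronese_surface K v.
Proof.
move=> nv r03 r05 r35 r04.
have [v0|v0] := eqVneq (v 0 s0) 0; last first.
  have nx : rv3 (v 0 s0) (v 0 s1) (v 0 s2) != 0 by apply: rv3_neq0; rewrite v0.
  exists (rv3 (v 0 s0) (v 0 s1) (v 0 s2)), (v 0 s0)^-1.
  rewrite veronese_map_neq0 // invr_eq0; split=> //; apply/rowP; elim/ord6_ind;
    rewrite [RHS]mxE veronese_mapE !rv3E -?r03 -?r05 -?r04 ?expr2 mulKf //.
have v1 : v 0 s1 = 0 by apply/eqP; rewrite -sqrf_eq0 -r03 v0 mul0r.
have v2 : v 0 s2 = 0 by apply/eqP; rewrite -sqrf_eq0 -r05 v0 mul0r.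
have [v3|v3] := eqVneq (v 0 s3) 0; last first.
  have nx : rv3 0 (v 0 s3) (v 0 s4) != 0 by apply: rv3_neq0; rewrite v3 orbT.
  exists (rv3 0 (v 0 s3) (v 0 s4)), (v 0 s3)^-1.
  rewrite veronese_map_neq0 // invr_eq0; split=> //; apply/rowP; elim/ord6_ind;
    rewrite [RHS]mxE veronese_mapE !rv3E -?r35 ?v0 ?v1 ?v2 ?expr2 ?mul0r ?mulr0 ?mulKf //.
have v4 : v 0 s4 = 0 by apply/eqP; rewrite -sqrf_eq0 -r35 v3 mul0r.
have nx : rv3 0 0 1 != 0 :> 'rV[K]_3 by apply: rv3_neq0; rewrite oner_eq0 !orbT.
exists (rv3 0 0 1), (v 0 s5); rewrite veronese_map_neq0 //.
have vE : v = v 0 s5 *: veronese_map (rv3 0 0 1).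
  apply/rowP; elim/ord6_ind;
  by rewrite [RHS]mxE veronese_mapE !rv3E ?v0 ?v1 ?v2 ?v3 ?v4 ?expr2 ?mul0r ?mulr0 ?mulr1.
by split=> //; apply: contraNneq nv => z; rewrite vE z scale0r.
Qed.

(** The images of the points $e_i$ and $e_i + e_j$ already form a basis of $K^6$. *)
Lemma veronese_span (W : {vspace 'rV[K]_6}) :
  (forall x, x != 0 -> veronese_map x \in W) -> W = fullv.
Proof.
move=> ver; apply/vspaceP => v; rewrite memvf.
have ver3 a b c : [|| a != 0, b != 0 | c != 0] -> veronese_map (rv3 a b c) \in W.
  by move=> nz; apply: ver; apply: rv3_neq0.
have n1 := oner_neq0 K.
have m0 : veronese_map (rv3 1 0 0) \in W by apply: ver3; rewrite n1.
have m1 : veronese_map (rv3 0 1 0) \in W by apply: ver3; rewrite n1 orbT.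
have m2 : veronese_map (rv3 0 0 1) \in W by apply: ver3; rewrite n1 !orbT.
have m01 : veronese_map (rv3 1 1 0) \in W by apply: ver3; rewrite n1.
have m02 : veronese_map (rv3 1 0 1) \in W by apply: ver3; rewrite n1.
have m12 : veronese_map (rv3 0 1 1) \in W by apply: ver3; rewrite n1 !orbT.
rewrite (_ : v = (v 0 s0 - v 0 s1 - v 0 s2) *: veronese_map (rv3 1 0 0)
  + (v 0 s3 - v 0 s1 - v 0 s4) *: veronese_map (rv3 0 1 0)
  + (v 0 s5 - v 0 s2 - v 0 s4) *: veronese_map (rv3 0 0 1)
  + v 0 s1 *: veronese_map (rv3 1 1 0) + v 0 s2 *: veronese_map (rv3 1 0 1)
  + v 0 s4 *: veronese_map (rv3 0 1 1)); first by do 5?apply: memvD; apply: memvZ.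
by apply/rowP; elim/ord6_ind; rewrite !mxDE !mxZE !veronese_mapE !rv3E; ring.
Qed.

Section LinearImage.
Variables (n : nat) (C : 'M[K]_(6, n)) (g : 'rV[K]_3 -> 'rV[K]_n).
Hypotheses (freeC : row_free C) (gE : forall x, g x = veronese_map x *m C).

Let D := pinvmx C.
Let CD : C *m D = 1%:M. Proof. exact: mulmxVp. Qed.

Lemma linear_image_neq0 x : x != 0 -> g x != 0.
Proof.
move=> nx; apply: contraNneq (veronese_map_neq0 nx) => g0.
by rewrite -[veronese_map x]mulmx1 -CD mulmxA -gE g0 mul0mx.
Qed.

Let lform m (A : 'M[K]_(n, m)) k : {mpoly K[n]} := \sum_i A i k *: 'X_i.

Let lformE m (A : 'M[K]_(n, m)) k (y : 'rV_n) : (lform A k).@[y 0] = (y *m A) 0 k.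
Proof.
rewrite /lform raddf_sum mxE; apply: eq_bigr => i _.
by rewrite /= mevalZ mevalXU mulrC.
Qed.

Let lform_homog m (A : 'M[K]_(n, m)) k : lform A k \is 1.-homog.
Proof.
by rewrite rpred_sum // => i _; rewrite rpredZ // dhomogX /= mdeg1.
Qed.

(** Linear equations from the cokernel of C place y in the row space of C. Quadratic ones, the
    Veronese equations pulled back along the right inverse D of C, place y D on the Veronese
    surface. *)
Lemma zariski_closure_linear_image y : zariski_closure (proj_image g) y ->
  exists2 v, y = v *m C & veronese_surface K v.
Proof.
move=> [ny hy]; have yE : y = y *m D *m C.
  apply/esym/mulmxKpV; rewrite submxE; apply/eqP/rowP => k.
  rewrite -lformE [RHS]mxE; apply: (hy 1%N) => // _ [x [c [_ _ _ ->]]].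
  by rewrite lformE gE -scalemxAl -mulmxA mulmx_coker mulmx0 scaler0 mxE.
exists (y *m D) => //.
have quad k l p q : (forall x : 'rV[K]_3, veronese_map x 0 k * veronese_map x 0 l
    = veronese_map x 0 p * veronese_map x 0 q) ->
    (y *m D) 0 k * (y *m D) 0 l = (y *m D) 0 p * (y *m D) 0 q.
  move=> rel; apply/eqP; rewrite -subr_eq0 -!lformE -!mevalM -mevalB; apply/eqP.
  apply: (hy 2%N) => [|_ [x [c [_ _ _ ->]]]].
    by rewrite rpredB // -[2%N]/(1 + 1)%N dhomogM.
  rewrite mevalB !mevalM !lformE gE -scalemxAl -mulmxA CD mulmx1 !mxZE.
  by rewrite ![c * _ * (c * _)]mulrACA rel subrr.
apply: veronese_surfaceP.
- by apply: contraNneq ny => v0; rewrite yE v0 mul0mx.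
- by apply: quad => x; rewrite !veronese_mapE; ring.
- by apply: quad => x; rewrite !veronese_mapE; ring.
- by apply: quad => x; rewrite !veronese_mapE; ring.
- by apply: quad => x; rewrite !veronese_mapE; ring.
Qed.

Lemma zariski_closure_linear_imageE y : zariski_closure (proj_image g) y <->
  exists2 v, y = v *m C & veronese_surface K v.
Proof.
split=> [|[_ -> [x [c [nx nv nc ->]]]]]; first exact: zariski_closure_linear_image.
have gx : c *: veronese_map x *m C = c *: g x by rewrite gE scalemxAl.
rewrite gx; split; first by rewrite scaler_eq0 negb_or nc linear_image_neq0.
by move=> d p _; apply; exists x, c; rewrite linear_image_neq0.
Qed.

(** The span of the closure is the image of v -> v C, because the Veronese surface spans $K^6$; the
    isomorphism back is multiplication by D. *)
Lemma linear_image_isomorphic :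
  linearly_isomorphic (zariski_closure (proj_image g)) (veronese_surface K).
Proof.
pose inC : 'Hom('rV[K]_6, 'rV[K]_n) := linfun (mulmxr C).
pose f : 'Hom('rV[K]_n, 'rV[K]_6) := linfun (mulmxr D).
have inCE v : inC v = v *m C by rewrite lfunE.
have fE y : f y = y *m D by rewrite lfunE.
have fK v : f (inC v) = v by rewrite fE inCE -mulmxA CD mulmx1.
have ver_in x : x != 0 -> veronese_surface K (veronese_map x).
  by move=> nx; exists x, 1; rewrite veronese_map_neq0 // oner_neq0 scale1r.
exists (limg inC), fullv, f; split.
- split=> [y /zariski_closure_linear_imageE[v -> _]|W hW].
    by rewrite -inCE memv_img ?memvf.
  apply/subvP => _ /memv_imgP[v _ ->].
  suff: v \in (inC @^-1: W)%VS by rewrite memv_preim.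
  rewrite (@veronese_span (inC @^-1: W)%VS) ?memvf // => x nx.
  rewrite -memv_preim; apply: hW; apply/zariski_closure_linear_imageE.
  by exists (veronese_map x); rewrite ?inCE //; exact: ver_in.
- split=> [v _|W hW]; first exact: memvf.
  by rewrite (@veronese_span W) ?subvv // => x /ver_in /hW.
- apply/eqP; rewrite -subv0; apply/subvP => y; rewrite memv_cap memv_ker.
  move=> /andP[/memv_imgP[v _ ->]]; rewrite fK => /eqP ->.
  by rewrite linear0 mem0v.
- apply/vspaceP => v; rewrite memvf; apply/memv_imgP.
  by exists (inC v); rewrite ?fK // memv_img ?memvf.
- apply/seteqP; split=> [_ [y /zariski_closure_linear_imageE[v -> hv] <-]|v hv].
    by rewrite -inCE fK.
  exists (v *m C); last by rewrite -inCE fK.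
  by apply/zariski_closure_linear_imageE; exists v.
Qed.

End LinearImage.
End Veronese.

(** * Singular points of determinantal cubics *)

Section LinearForms.
Variable K : fieldType.
Implicit Types (M : 'M[K]_3) (S : 'I_3 -> 'M[K]_3) (x y z : 'rV[K]_3).

Lemma cofactorE (R : comNzRingType) (M : 'M[R]_3) a b :
  cofactor M a b = if odd (a + b) then - minors M a b else minors M a b.
Proof.
by rewrite /cofactor [minors M a b]mxE -signr_odd; case: odd; rewrite ?mulN1r ?mul1r.
Qed.

(** Column b of the cofactors is, up to sign, the cross product of the other two columns of M. Both
    are orthogonal to y, so the cross product is parallel to y. *)
Lemma left_kernel_cofactor M y a a' b : y *m M = 0 ->
  y 0 a' * cofactor M a b = y 0 a * cofactor M a' b.
Proof.
have [[l1 l2 l3] [l4 l5 l6]] := lift_ord3.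
move=> yM.
(* W p q c is the wedge of the relation yM = 0, in columns p and q, with row c. *)
have W p q c : (y 0 o0 * M o0 p + y 0 o1 * M o1 p + y 0 o2 * M o2 p) * M c q
    - (y 0 o0 * M o0 q + y 0 o1 * M o1 q + y 0 o2 * M o2 q) * M c p = 0.
  have e j : y 0 o0 * M o0 j + y 0 o1 * M o1 j + y 0 o2 * M o2 j = 0.
    by have /rowP /(_ j) := yM; rewrite !mxE big_ord3.
  by rewrite !e !mul0r subrr.
rewrite !cofactorE; apply/eqP; rewrite -subr_eq0; apply/eqP.
move: a a' b; elim/ord3_ind; elim/ord3_ind; elim/ord3_ind;
  rewrite !minorsE !(l1, l2, l3, l4, l5, l6) /=;
  let t p q := solve [rewrite -[RHS](W p q o0); ring
    | rewrite -[RHS](W p q o1); ring | rewrite -[RHS](W p q o2); ring] in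
  let u p q := first [t p q | t q p] in
  solve [ring | u constr:(o0) constr:(o1) | u constr:(o0) constr:(o2)
    | u constr:(o1) constr:(o2)].
Qed.

Lemma right_kernel_cofactor M z a b b' : M *m z^T = 0 ->
  z 0 b' * cofactor M a b = z 0 b * cofactor M a b'.
Proof.
move=> Mz; rewrite -![cofactor M a _]cofactor_tr; apply: left_kernel_cofactor.
by rewrite -[z]trmxK -trmx_mul Mz trmx0.
Qed.

Definition linear_forms_mx S : 'M[{mpoly K[3]}]_3 :=
  \matrix_(a, b) \sum_(c < 3) S c a b *: 'X_c.

Lemma meval_linear_forms S x a b :
  (linear_forms_mx S a b).@[x 0] = (\sum_c x 0 c *: S c) a b.
Proof.
rewrite mxE raddf_sum summxE; apply: eq_bigr => c _.
by rewrite /= mevalZ mevalXU mxE mulrC.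
Qed.

Lemma mderiv_linear_forms S k a b :
  (linear_forms_mx S a b)^`M(k) = (S k a b)%:MP.
Proof.
rewrite mxE raddf_sum (bigD1 k) //= big1 ?addr0 => [|c ck]; rewrite mderivZ mderivX mnm1E.
  have -> : (U_(k) - U_(k))%MM = 0%MM :> 'X_{1..3}.
    by apply/mnmP => i; rewrite mnmBE subnn mnm0E.
  by rewrite eqxx scale1r mpolyX0 -mul_mpolyC mulr1.
by rewrite (negPf ck) scale0r scaler0.
Qed.

(** Jacobi's formula for the derivative of a determinant. *)
Lemma mderiv_det_linear_forms S x k :
  ((\det (linear_forms_mx S))^`M(k)).@[x 0] =
  \sum_a \sum_b S k a b * cofactor (\sum_c x 0 c *: S c) a b.
Proof.
have [[l1 l2 l3] [l4 l5 l6]] := lift_ord3.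
rewrite det_mx3 !minorsE !(l1, l2, l3, l4, l5, l6).
rewrite !(mderivD, mderivN, mderivM) !mderiv_linear_forms.
rewrite !(mevalD, mevalN, mevalM) !mevalC !meval_linear_forms.
move: (\sum_c x 0 c *: S c) => M.
rewrite !big_ord3 !cofactorE !minorsE !(l1, l2, l3, l4, l5, l6) /=.
ring.
Qed.

(** A degenerate triple makes x a singular point. It lies on the cubic since y M = 0, and both
    kernel conditions make the cofactor matrix proportional to $y^T z$. By Jacobi's formula each
    partial derivative at x is then a multiple of $y S_k z^T = 0$. *)
Lemma smooth_nondegenerate S :
  smooth_plane_cubic (\det (linear_forms_mx S)) -> ~ degenerate S.
Proof.
move=> [_ _ smooth] [x [y [z [[nx ny nz] [yM Mz ySz]]]]].
have [|k] := smooth x nx.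
  rewrite -det_map_mx (_ : map_mx _ _ = \sum_c x 0 c *: S c); last first.
    by apply/matrixP => a b; rewrite -meval_linear_forms [LHS]mxE.
  by apply/eqP/det0P; exists y.
case/eqP; rewrite mderiv_det_linear_forms.
move: (\sum_c x 0 c *: S c) yM Mz => M yM Mz.
have [a ya] : exists a, y 0 a != 0 by apply/rV0Pn.
have [b zb] : exists b, z 0 b != 0 by apply/rV0Pn.
apply: (mulfI ya); apply: (mulfI zb); rewrite !mulr0.
transitivity (cofactor M a b * (y *m S k *m z^T) 0 0); last first.
  by rewrite ySz mxE mulr0.
rewrite -mulmxA [in RHS]mxE !mulr_sumr; apply: eq_bigr => a' _.
rewrite [in RHS]mxE !mulr_sumr; apply: eq_bigr => b' _; rewrite [in RHS]mxE.
transitivity (S k a' b' * (z 0 b * (y 0 a * cofactor M a' b'))); first by ring.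
rewrite -(left_kernel_cofactor a a' b' yM).
transitivity (S k a' b' * (y 0 a' * (z 0 b * cofactor M a b'))); first by ring.
by rewrite -(right_kernel_cofactor a b b' Mz); ring.
Qed.

End LinearForms.

(** * The slices of the tensor and their permutations *)

Section Collineation.
Variables (K : fieldType) (V : 'I_3 -> vectType K).
Variables (e : forall k, 3.-tuple (dual (V k))) (T : tensor V).

Definition slice (i j l c : 'I_3) : 'M[K]_3 :=
  \matrix_(a, b) contraction T (tnth (e i) c) (tnth (e j) a) (tnth (e l) b).

Lemma flatteningE i j l : flattening e T i j l = linear_forms_mx (slice i j l).
Proof.
by apply/matrixP => a b; rewrite !mxE; apply: eq_bigr => c _; rewrite mxE.
Qed.

Lemma collineation_mapE i j l x :
  collineation_map e T i j l x = mxvec (minors (\sum_c x 0 c *: slice i j l c)).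
Proof.
congr mxvec; apply/matrixP => a b; rewrite [LHS]mxE [RHS]mxE -det_map_mx flatteningE.
congr (\det _); apply/matrixP => a' b'; rewrite [RHS]mxE [RHS]mxE -meval_linear_forms.
by rewrite [LHS]mxE; congr (_.@[_]); rewrite [LHS]mxE [LHS]mxE.
Qed.

Lemma dfwith_swap (f : forall k, dual (V k)) (i j : 'I_3) (u : dual (V i)) (v : dual (V j)) :
  i != j -> dfwith (dfwith f u) v = dfwith (dfwith f v) u.
Proof.
move=> ij; apply/functional_extensionality_dep => k.
case: dfwithP => [|k' jk].
  by rewrite dfwith_out // dfwith_in.
move: jk; case: dfwithP => [_|k'' ik jk]; first by rewrite dfwith_in.
by rewrite !dfwith_out.
Qed.

Lemma slice_swap_ij i j l c a b : i != j -> slice i j l c a b = slice j i l a c b.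
Proof. by move=> ij; rewrite !mxE /contraction (dfwith_swap _ _ _ ij). Qed.

Lemma slice_swap_jl i j l c a b : j != l -> slice i j l c a b = slice i l j c b a.
Proof. by move=> jl; rewrite !mxE /contraction (dfwith_swap _ _ _ jl). Qed.

End Collineation.

(** * Symmetry of degeneracy in the three factors *)

Section DegenerateSymmetry.
Variable K : fieldType.
Implicit Types (S : 'I_3 -> 'M[K]_3).

(** Exchanging y and z exchanges the first two conditions and keeps the third. *)
Lemma degenerate_tr S S' : (forall c a b, S' c a b = S c b a) ->
  degenerate S -> degenerate S'.
Proof.
move=> SE [x [y [z [[nx ny nz] [e1 e2 e3]]]]].
have S'E c : S' c = (S c)^T by apply/matrixP => a b; rewrite SE mxE.
have E : \sum_c x 0 c *: S' c = (\sum_c x 0 c *: S c)^T.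
  by rewrite linear_sum /=; apply: eq_bigr => c _; rewrite S'E linearZ.
exists x, z, y; split=> //; rewrite E; split.
- by apply: trmx_inj; rewrite trmx_mul trmxK e2 trmx0.
- by rewrite -trmx_mul e1 trmx0.
- by move=> c; apply: trmx_inj; rewrite S'E !trmx_mul !trmxK mulmxA e3 trmx0.
Qed.

(** Exchanging x and y keeps the first condition and exchanges the other two. *)
Lemma degenerate_exchange S S' : (forall c a b, S' c a b = S a c b) ->
  degenerate S -> degenerate S'.
Proof.
move=> SE [x [y [z [[nx ny nz] [e1 e2 e3]]]]].
exists y, x, z; split=> //; split.
- apply/rowP => b; rewrite mxE [RHS]mxE.
  rewrite -[RHS](_ : (y *m \sum_c x 0 c *: S c) 0 b = 0); last by rewrite e1 mxE.
  rewrite [RHS]mxE.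
  transitivity (\sum_j \sum_c x 0 j * (y 0 c * S' c j b)).
    by apply: eq_bigr => j _; rewrite summxE mulr_sumr; apply: eq_bigr => c _; rewrite !mxE.
  rewrite exchange_big; apply: eq_bigr => c _; rewrite summxE mulr_sumr.
  by apply: eq_bigr => j _; rewrite mxE SE mulrCA.
- apply/colP => a; rewrite [RHS]mxE.
  rewrite -[RHS](_ : (y *m S a *m z^T) 0 0 = 0); last by rewrite e3 mxE.
  rewrite !mxE; apply: eq_bigr => b _; congr (_ * _).
  by rewrite summxE mxE; apply: eq_bigr => c _; rewrite mxE SE.
- move=> c; apply/matrixP => i j; rewrite !ord1 [RHS]mxE.
  rewrite -[RHS](_ : ((\sum_k x 0 k *: S k) *m z^T) c 0 = 0); last by rewrite e2 mxE.
  rewrite !mxE; apply: eq_bigr => b _; congr (_ * _).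
  by rewrite summxE mxE; apply: eq_bigr => k _; rewrite mxE SE.
Qed.

End DegenerateSymmetry.

(** * The collineation varieties as linear images of the Veronese surface *)

Lemma minors_linear_combination (K : numClosedFieldType) (S : 'I_3 -> 'M[K]_3)
    (x : 'rV[K]_3) :
  mxvec (minors (\sum_c x 0 c *: S c)) = veronese_map x *m minor_coefs S.
Proof.
rewrite mulmx_sum_row big_ord6 !rowK !veronese_mapE /= -!linearZ -!linearD.
congr mxvec; apply/matrixP => a b.
have sumE i j : (\sum_c x 0 c *: S c) i j
    = x 0 o0 * S o0 i j + x 0 o1 * S o1 i j + x 0 o2 * S o2 i j.
  by rewrite summxE big_ord3 !mxZE.
rewrite minorsE !sumE; symmetry.
have combE (X0 X1 X2 X3 X4 X5 : 'M[K]_3) (r0 r1 r2 r3 r4 r5 : K) :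
    (r0 *: X0 + r1 *: X1 + r2 *: X2 + r3 *: X3 + r4 *: X4 + r5 *: X5) a b =
    r0 * X0 a b + r1 * X1 a b + r2 * X2 a b + r3 * X3 a b + r4 * X4 a b + r5 * X5 a b.
  by rewrite !mxE.
by rewrite combE !minorsE !minorsDE; ring.
Qed.

(** The two adjacent transpositions generate all orderings, which carries smoothness of one cubic
    over to all three flattenings. *)
Lemma degenerate_slice_perm (K : fieldType) (V : 'I_3 -> vectType K)
    (e : forall k, 3.-tuple (dual (V k))) (T : tensor V) (i j l : 'I_3) :
  uniq [:: i; j; l] ->
  degenerate (slice e T i j l) -> degenerate (slice e T o0 o1 o2).
Proof.
have swap_ij i' j' l' : i' != j' ->
    degenerate (slice e T i' j' l') -> degenerate (slice e T j' i' l').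
  by rewrite eq_sym => ij; apply: degenerate_exchange => c a b; apply: slice_swap_ij.
have swap_jl i' j' l' : j' != l' ->
    degenerate (slice e T i' j' l') -> degenerate (slice e T i' l' j').
  by rewrite eq_sym => jl; apply: degenerate_tr => c a b; apply: slice_swap_jl.
move: i j l; elim/ord3_ind; elim/ord3_ind; elim/ord3_ind => //= _ D.
- exact: (swap_jl o0 o2 o1).
- exact: (swap_ij o1 o0 o2).
- by apply: (swap_ij o1 o0 o2) => //; apply: (swap_jl o1 o2 o0).
- by apply: (swap_jl o0 o2 o1) => //; apply: (swap_ij o2 o0 o1).
- have D' := swap_jl o2 o1 o0 isT D.
  by apply: (swap_jl o0 o2 o1) => //; apply: (swap_ij o2 o0 o1).
Qed.

Theorem theorem4p4 (R : realType) (V : 'I_3 -> vectType R[i])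
    (dimV : forall k : 'I_3, \dim {: V k} = 3%N)
    (e : forall k : 'I_3, 3.-tuple (dual (V k)))
    (basis_e : forall k : 'I_3, basis_of {: dual (V k)} (e k))
    (T : tensor V)
    (smoothE : smooth_plane_cubic
       (flattening_det e T (inord 0) (inord 1) (inord 2))) :
  forall i j l : 'I_3, uniq [:: i; j; l] ->
    linearly_isomorphic (collineation_variety e T i j l)
                        (veronese_surface R[i]).
Proof.
move=> i j l uijl; apply: (@linear_image_isomorphic _ _ (minor_coefs (slice e T i j l))).
  apply: minor_coefs_free => D.
  apply: (smooth_nondegenerate _ (degenerate_slice_perm uijl D)).
  by rewrite -flatteningE -!inord3.
by move=> x; rewrite collineation_mapE; apply: minors_linear_combination.
Qed.
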